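(* Let $k\ge 1$, $b>0$, $c>0$ be integers. If there exist nonnegative integers $l_1,\dots,l_k$ such that the infinite circulant graph $C_\infty(l_1,\dots,l_k)$ with $k$ distances has a perfect $2$-colouring with parameters $(b,c)$, then for each prime $q$ and each positive integer $t$ such that $q^t$ divides $\frac{b+c}{\gcd(b,c)}$, it holds that $$b+c\le 2k+\frac{b+c}{q^t}.$$
   Context: Graphs may have loops and multiple edges. The infinite circulant graph with $k$ distances $C_\infty(l_1,\dots,l_k)$ has vertex set $\mathbb{Z}$, and numbers differing by $l_i$, for some $i$, are joined by an edge; it is $2k$-regular, the neighbours of a vertex $g$, counted with multiplicity, being $g+l_i$ and $g-l_i$ for $i=1,\dots,k$. (The $l_i$ are not required to be distinct or nonzero.) A perfect $2$-colouring with parameters $(b,c)$ of a regular graph is a colouring of its vertices in two colours (black and white) such that each black vertex has exactly $b$ white neighbours and each white vertex has exactly $c$ black neighbours (neighbours counted with multiplicity). *)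

(* Defs.v *)
From mathcomp Require Import all_boot all_order all_algebra.

Set Implicit Arguments.
Unset Strict Implicit.
Unset Printing Implicit Defensive.

Import GRing.Theory.

Local Open Scope ring_scope.

(* A multigraph on V is encoded by the function sending a vertex to the list of
   its neighbours, in which each neighbour occurs as often as its multiplicity. *)
Definition circulant_nbrs (k : nat) (l : k.-tuple nat) (g : int) : seq int :=
  [seq g + d%:Z | d <- l] ++ [seq g - d%:Z | d <- l].

(* A 2-colouring is the predicate [black]; the white vertices are the others. *)
Definition perfect_2colouring (V : Type) (nbrs : V -> seq V) (b c : nat)
    (black : pred V) : Prop :=
  (forall v, black v -> count (predC black) (nbrs v) = b) /\
  (forall v, ~~ black v -> count black (nbrs v) = c).

(* Main.v *)
Require Import Defs.
From mathcomp Require Import all_boot all_order all_algebra all_field.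
From mathcomp Require Import zify ring.

(* A perfect colouring is periodic, since its restriction to a window of length
   twice the largest distance determines it in both directions.  Let [n] be a
   period, [lambda := 2 k - (b + c)], [N] the number of black vertices in a
   period, [F z] the sum of [z ^ v] over these vertices, and [P z] the sum of
   [z ^ l_i + z ^ - l_i], minus [lambda].  Then [P z * F z = 0] whenever
   [z ^ n = 1 != z], and [(b + c) N = c n].

   For each [j < logn q n] one of [P], [F] vanishes at a primitive
   [q ^ j.+1]-th root of unity, hence at all of its Galois conjugates.  If it is
   [P], then [D j = q * D j.+1], where [D j] is the number of distances
   [l_i, - l_i] divisible by [q ^ j], minus [lambda].  If it is [F], then the
   number of black vertices in a class modulo [q ^ j] is [q] times their number
   in the same class modulo [q ^ j.+1].  If the second case occurs [m] times,
   then [q ^ m] divides [N], which forces [m + t <= logn q n]; so the first case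
   occurs at least [t] times.  As [- lambda <= D j] and [D] is nonincreasing, this
   gives [q ^ t * - lambda <= D 0 = b + c] when [lambda < 0]. *)

Set Implicit Arguments.
Unset Strict Implicit.
Unset Printing Implicit Defensive.

Import Order.TTheory GRing.Theory Num.Theory.

Local Open Scope ring_scope.

(** * Roots of unity, Ramanujan sums and residue classes *)

Lemma prim_root_neq0 (F : fieldType) n (z : F) : n.-primitive_root z -> z != 0.
Proof.
move=> zP; apply/eqP=> z0; have := prim_expr_order zP.
have := prim_order_gt0 zP; rewrite z0; case: n {zP} => // n _.
by rewrite expr0n /= => /esym/eqP; rewrite oner_eq0.
Qed.

Lemma prim_order_dvdz (F : fieldType) n (z : F) (e : int) :
  n.-primitive_root z -> (n %| e)%Z = (z ^ e == 1).
Proof.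
move=> zP; case: e => m; first by rewrite dvdzE -(prim_order_dvd zP).
by rewrite NegzE dvdzE abszN -exprnN invr_eq1 -(prim_order_dvd zP).
Qed.

Lemma sum_prim_root_exprz (F : fieldType) n (z : F) (e : int) :
  n.-primitive_root z ->
  \sum_(u < n) (z ^+ u) ^ e = if (n %| e)%Z then n%:R else 0.
Proof.
move=> zP; rewrite (prim_order_dvdz e zP).
under eq_bigr => u _ do rewrite exprnP exprz_exp mulrC -exprz_exp -exprnP.
case: eqP => [-> | /eqP ze1].
  under eq_bigr do rewrite expr1n.
  by rewrite sumr_const card_ord.
apply: (mulfI (x := z ^ e - 1)); first by rewrite subr_eq0.
rewrite mulr0 -[LHS]subrX1.
by rewrite exprnP exprz_exp mulrC -exprz_exp -exprnP (prim_expr_order zP) exp1rz subrr.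
Qed.

(* Ramanujan sums: the Galois conjugates [z ^+ u], [u] prime to [q], are zeros
   too, so the sum over all [u < q ^ j.+1] reduces to the multiples of [q]; both
   sums are then evaluated by orthogonality of characters. *)
Lemma sum_dvdz_of_prim_root_eq0 (q j : nat) (z : algC) (I : Type) (r : seq I)
    (w e : I -> int) :
  prime q -> (q ^ j.+1).-primitive_root z ->
  \sum_(i <- r) (w i)%:~R * z ^ e i = 0 ->
  \sum_(i <- r | ((q ^ j)%N %| e i)%Z) w i =
  q%:Z * \sum_(i <- r | ((q ^ j.+1)%N %| e i)%Z) w i.
Proof.
move=> q_pr zP Gz0; have q_gt0 := prime_gt0 q_pr.
pose G (y : algC) : algC := \sum_(i <- r) (w i)%:~R * y ^ e i.
have z_neq0 := prim_root_neq0 zP.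
have Gconj u : ~~ (q %| u)%N -> G (z ^+ u) = 0.
  move=> qNu; have /Qn_aut_exists[s sE] : coprime u (q ^ j.+1).
    by rewrite coprime_sym coprimeXl // prime_coprime.
  rewrite -(sE _ (prim_expr_order zP)) -[RHS](rmorph0 s) -Gz0 rmorph_sum.
  apply: eq_bigr => i _.
  by rewrite rmorphM rmorph_int /= rmorphXz // unitfE.
have sumG n y : n.-primitive_root y ->
    \sum_(u < n) G (y ^+ u) = n%:R * (\sum_(i <- r | (n %| e i)%Z) w i)%:~R.
  move=> yP; rewrite exchange_big /= rmorph_sum mulr_sumr [RHS]big_mkcond.
  apply: eq_bigr => i _; rewrite -mulr_sumr (sum_prim_root_exprz _ yP).
  by case: ifP => _; rewrite ?mulr0 // mulrC.
have zqP : (q ^ j).-primitive_root (z ^+ q).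
  have := exp_prim_root zP q.
  have -> : gcdn q (q ^ j.+1) = q by apply/gcdn_idPl; rewrite expnS dvdn_mulr.
  by rewrite expnS mulKn.
have : \sum_(u < q ^ j.+1) G (z ^+ u) = \sum_(u < q ^ j) G ((z ^+ q) ^+ u).
  rewrite -(big_mkord xpredT (fun u => G (z ^+ u))) expnSr big_nat_mul.
  rewrite big_mkord; apply: eq_bigr => u _.
  rewrite big_ltn ?ltn_pmul2r //= mulnC exprM.
  rewrite big_nat big1 ?addr0 // => v /andP[lo hi]; apply: Gconj.
  apply/negP => /dvdnP[y vE]; move: lo hi.
  by rewrite vE mulnC !ltn_pmul2r //; lia.
rewrite (sumG _ _ zP) (sumG _ _ zqP) expnS natrM -mulrA mulrCA.
have qj_neq0 : (q ^ j)%:R != 0 :> algC by rewrite pnatr_eq0 -lt0n expn_gt0 q_gt0.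
move=> /(mulfI qj_neq0); rewrite -[q%:R]/(q%:Z%:~R) -rmorphM /=.
by move=> /eqP; rewrite eqr_int => /eqP.
Qed.

Lemma sum_residue_split (q n : nat) (x : int) : (0 < q)%N -> (0 < n)%N ->
  (\sum_(i < q) ((q * n)%N %| (x - (i * n)%N%:Z)%R)%Z)%N = (n %| x)%Z.
Proof.
move=> q_gt0 n_gt0; have n_neq0 : n%:Z != 0 by lia.
have [/dvdzP[y ->] | nNx] := boolP (n %| x)%Z; last first.
  rewrite big1 // => i _; apply/eqP; rewrite eqb0; apply: contra nNx => qnx.
  have : (n %| x - (i * n)%N%:Z)%Z.
    by apply: dvdz_trans qnx; rewrite dvdzE dvdn_mull.
  by rewrite rpredBr // dvdzE dvdn_mull.
have q_neq0 : q%:Z != 0 by lia.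
have [ge0 lt_q] : 0 <= (y %% q)%Z /\ (y %% q)%Z < q%:Z.
  by rewrite modz_ge0 // ltz_pmod.
have lt_yq : (`|(y %% q)%Z| < q)%N by lia.
rewrite (bigD1 (Ordinal lt_yq)) //= big1 => [|i].
  rewrite !PoszM -mulrBl dvdz_mul2r // gez0_abs //.
  by rewrite -eqz_mod_dvd modz_mod eqxx.
rewrite !PoszM -mulrBl dvdz_mul2r // -eqz_mod_dvd => i_neq.
apply/eqP; rewrite eqb0; apply: contra i_neq => /eqP yE.
apply/eqP/val_inj; rewrite /= yE modz_small //; have := ltn_ord i; lia.
Qed.

(** * Periodicity of perfect colourings *)

(** The adjacency operator of the circulant graph, on integer-valued functions so that it also
    applies to differences of colourings. *)
Definition nbr_sum (l : seq nat) (f : int -> int) (v : int) : int :=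
  \sum_(d <- l) (f (v + d%:Z) + f (v - d%:Z)).

(** A black vertex has [2 k - b = c + (2 k - (b + c))] black neighbours and a white one has [c]. *)
Lemma nbr_sum_perfect k b c (l : k.-tuple nat) (black : pred int) (v : int) :
  perfect_2colouring (circulant_nbrs l) b c black ->
  nbr_sum l (fun x => (black x)%:R) v =
  c%:Z + ((2 * k)%N%:Z - (b + c)%N%:Z) * (black v)%:R.
Proof.
case=> blackP whiteP; set nbrs := circulant_nbrs l v.
have -> : nbr_sum l (fun x => (black x)%:R) v = (count black nbrs)%:Z.
  rewrite /nbrs /circulant_nbrs count_cat !count_map -!sum1_count.
  rewrite big_mkcond [X in (_ + X)%N]big_mkcond /= -big_split /= -natz natr_sum.
  by apply: eq_bigr => d _; do 2!case: ifP => _.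
have := count_predC black nbrs.
rewrite /nbrs /circulant_nbrs size_cat !size_map size_tuple -/nbrs.
case: (boolP (black v)) => [/blackP | /whiteP] -> /=; lia.
Qed.

(** At the centre of a window lengthened by one point, the equation involves the new point only
    through the largest distance [m], with coefficient the multiplicity of [m] in [l], which is
    positive. *)
Lemma nbr_sum_eq0_step (l : seq nat) (la : int) (g : int -> int) (m : nat) (v : int) :
  m \in l -> (0 < m)%N -> (forall d, d \in l -> d <= m)%N ->
  (forall x, nbr_sum l g x = la * g x) ->
  (forall x, v <= x < v + (2 * m)%N%:Z -> g x = 0) ->
  g (v + (2 * m)%N%:Z) = 0 /\ g (v - 1) = 0.
Proof.
move=> ml m_gt0 le_m gE g0.
have key x y : g x = 0 ->
    (forall d, d \in l -> g (x + d%:Z) + g (x - d%:Z) = (d == m)%:R * g y) ->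
    g y = 0.
  move=> gx0 gxd; have := gE x; rewrite gx0 mulr0 /nbr_sum big_seq.
  under eq_bigr => d /gxd -> do [].
  rewrite -big_seq -mulr_suml -natr_sum.
  have -> : (\sum_(d <- l) (d == m) = count_mem m l)%N.
    by rewrite -sum1_count [RHS]big_mkcond; apply: eq_bigr => d _ /=; case: eqP.
  move/eqP.
  rewrite mulf_eq0 => /orP[|/eqP //].
  by rewrite pnatr_eq0 eqn0Ngt -has_count has_pred1 ml.
split.
  apply: (key (v + m%:Z)) => [|d dl]; first by apply: g0; lia.
  have dm := le_m d dl; case: eqVneq => [-> | d_neq].
    rewrite [g (_ - _)]g0 ?addr0 ?mul1r; last by lia.
    by congr g; lia.
  by rewrite mul0r !g0 //; lia.
apply: (key (v - 1 + m%:Z)) => [|d dl]; first by apply: g0; lia.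
have dm := le_m d dl; case: eqVneq => [-> | d_neq].
  rewrite [g (_ + _)]g0 ?add0r ?mul1r; last by lia.
  by congr g; lia.
by rewrite mul0r !g0 //; lia.
Qed.

Lemma nbr_sum_eq0 (l : seq nat) (la : int) (g : int -> int) (m : nat) (v : int) :
  m \in l -> (0 < m)%N -> (forall d, d \in l -> d <= m)%N ->
  (forall x, nbr_sum l g x = la * g x) ->
  (forall x, v <= x < v + (2 * m)%N%:Z -> g x = 0) ->
  forall x, g x = 0.
Proof.
move=> ml m_gt0 le_m gE g0.
pose window0 y := forall x, y <= x < y + (2 * m)%N%:Z -> g x = 0.
have step y : window0 y -> window0 (y + 1) /\ window0 (y - 1).
  move=> wy; have [gr gl] := nbr_sum_eq0_step ml m_gt0 le_m gE wy.
  split=> x xP; have [/wy // | nxP] := boolP (y <= x < y + (2 * m)%N%:Z).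
    by rewrite -gr; congr g; lia.
  by rewrite -gl; congr g; lia.
have right (i : nat) : window0 (v + i%:Z).
  elim: i => [|i /step[wi _]]; first by rewrite addr0.
  by rewrite intS addrCA addrC.
have left (i : nat) : window0 (v - i%:Z).
  elim: i => [|i /step[_ wi]]; first by rewrite subr0.
  by rewrite intS opprD addrCA addrC.
move=> x; case: (lerP v x) => vx.
  by apply: (right `|x - v|%N); lia.
by apply: (left `|x - v|%N); lia.
Qed.

(** By pigeonhole two windows of length [2 * m] carry the same pattern. The difference of the
    colouring and its translate satisfies the equation without the constant [c] and vanishes on a
    window, hence everywhere. *)
Lemma colouring_periodic (l : seq nat) (la c : int) (black : pred int) (m : nat) :
  m \in l -> (0 < m)%N -> (forall d, d \in l -> d <= m)%N ->
  (forall v, nbr_sum l (fun x => (black x)%:R) v = c + la * (black v)%:R) ->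
  exists2 n : nat, (0 < n)%N & forall v, black (v + n%:Z) = black v.
Proof.
move=> ml m_gt0 le_m blackE.
(* There is one more starting point than there are patterns. *)
pose pattern (i : 'I_#|{ffun 'I_(2 * m) -> bool}|.+1) : {ffun 'I_(2 * m) -> bool} :=
  [ffun y : 'I_(2 * m) => black (i%:Z + y%:Z)].
have /injectivePn[i [j ij eq_ij]] : ~~ injectiveb pattern.
  by apply/injectiveP => /leq_card; rewrite card_ord ltnn.
wlog lt_ij : i j ij eq_ij / (i < j)%N.
  move=> gen; have := ij; rewrite neq_ltn => /orP[]; first exact: gen.
  by apply: gen; rewrite // eq_sym.
exists (j - i)%N; first by rewrite subn_gt0.
pose g x : int := (black (x + (j - i)%N%:Z))%:R - (black x)%:R.
have gE x : nbr_sum l g x = la * g x.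
  transitivity (nbr_sum l (fun x => (black x)%:R) (x + (j - i)%N%:Z) -
                nbr_sum l (fun x => (black x)%:R) x).
    rewrite /nbr_sum -sumrB; apply: eq_bigr => d _.
    by rewrite /g ![_ + (j - i)%N%:Z]addrAC opprD addrACA.
  by rewrite !blackE /g; ring.
suff g0 x : i%:Z <= x < i%:Z + (2 * m)%N%:Z -> g x = 0.
  move=> v; have /eqP := nbr_sum_eq0 ml m_gt0 le_m gE g0 v.
  by rewrite subr_eq0 eqr_nat; do 2!case: (black _).
move=> xP; have lt_x : (`|x - i%:Z| < 2 * m)%N by lia.
have /(congr1 (fun f : {ffun _ -> bool} => f (Ordinal lt_x))) := eq_ij.
rewrite !ffunE /= /g; have -> : i%:Z + `|x - i%:Z|%N%:Z = x by lia.
have -> : j%:Z + `|x - i%:Z|%N%:Z = x + (j - i)%N%:Z by lia.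
by move=> ->; rewrite subrr.
Qed.

(** * Fourier transform over one period *)

Lemma sum_period_shift (V : nmodType) (n : nat) (G : int -> V) (a : int) :
  (forall v, G (v + n%:Z) = G v) ->
  \sum_(v < n) G (v%:Z + a) = \sum_(v < n) G v%:Z.
Proof.
move=> Gper.
have shift1 b : \sum_(v < n) G (v%:Z + (b + 1)) = \sum_(v < n) G (v%:Z + b).
  case: n Gper => [|n] Gper; first by rewrite !big_ord0.
  rewrite big_ord_recr big_ord_recl /= [RHS]addrC; congr (_ + _).
    by apply: eq_bigr => i _; congr G; rewrite /bump /=; lia.
  by rewrite -(Gper (0 + b)); congr G; lia.
have -> : \sum_(v < n) G v%:Z = \sum_(v < n) G (v%:Z + 0).
  by apply: eq_bigr => v _; rewrite addr0.
elim/int_rect: a => [|a IH|a IH] //; rewrite intS.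
  by rewrite [1 + _]addrC shift1.
by rewrite -shift1 -[RHS]IH; apply: eq_bigr => v _; congr G; lia.
Qed.

(** Translating [f] by [a] multiplies its transform at [z] by [z ^ (- a)], so the adjacency operator
    acts on transforms as a multiplication. *)
Lemma nbr_sum_fourier (l : seq nat) (f : int -> int) (la c : int) (n : nat) (z : algC) :
  (0 < n)%N -> z ^+ n = 1 -> (forall v : int, f (v + n%:Z) = f v) ->
  (forall v, nbr_sum l f v = c + la * f v) ->
  (\sum_(d <- l) (z ^ d%:Z + z ^ (- d%:Z)) - la%:~R) *
    (\sum_(v < n) (f v%:Z)%:~R * z ^ v%:Z) =
  c%:~R * \sum_(v < n) z ^ v%:Z.
Proof.
move=> n_gt0 zn1 fper fE; set F := \sum_(v < n) _ * _.
have z_neq0 : z != 0.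
  by apply: contraTneq (oner_neq0 algC) => z0; rewrite -zn1 z0 expr0n gtn_eqF ?eqxx.
have shift a : \sum_(v < n) (f (v%:Z + a))%:~R * z ^ v%:Z = z ^ (- a) * F.
  transitivity (z ^ (- a) * \sum_(v < n) (f (v%:Z + a))%:~R * z ^ (v%:Z + a)).
    rewrite mulr_sumr; apply: eq_bigr => v _.
    by rewrite mulrCA -expfzDr // addrCA addNr addr0.
  rewrite (sum_period_shift (G := fun x => (f x)%:~R * z ^ x)) // => v.
  by rewrite fper expfzDr // -exprnP zn1 mulr1.
have : \sum_(v < n) (nbr_sum l f v%:Z)%:~R * z ^ v%:Z =
       (\sum_(d <- l) (z ^ d%:Z + z ^ (- d%:Z))) * F.
  rewrite mulr_suml; under eq_bigr => v _ do rewrite rmorph_sum mulr_suml.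
  rewrite exchange_big; apply: eq_bigr => d _ /=.
  under eq_bigr => v _ do rewrite rmorphD mulrDl.
  by rewrite big_split /= !shift opprK mulrDl addrC.
rewrite mulrBl => <-; apply/eqP; rewrite subr_eq; apply/eqP.
rewrite /F !mulr_sumr -big_split; apply: eq_bigr => v _ /=.
by rewrite fE rmorphD rmorphM /= mulrDl mulrA.
Qed.

(** The case [z = 1] of the Fourier identity; it fixes the density of black vertices. *)
Lemma sum_nbr_sum (l : seq nat) (f : int -> int) (la c : int) (n : nat) :
  (0 < n)%N -> (forall v : int, f (v + n%:Z) = f v) ->
  (forall v, nbr_sum l f v = c + la * f v) ->
  ((2 * size l)%N%:Z - la) * (\sum_(v < n) f v%:Z) = c * n%:Z.
Proof.
move=> n_gt0 fper fE.
have := nbr_sum_fourier n_gt0 (expr1n _ n) fper fE.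
have -> : \sum_(d <- l) (1 ^ d%:Z + 1 ^ (- d%:Z)) = (2 * size l)%N%:Z%:~R :> algC.
  under eq_bigr => d _ do rewrite !exp1rz.
  by rewrite big_const_seq iter_addr_0 count_predT -mulr2n -mulrnA.
have -> : \sum_(v < n) (f v%:Z)%:~R * 1 ^ v%:Z = (\sum_(v < n) f v%:Z)%:~R :> algC.
  by rewrite rmorph_sum; apply: eq_bigr => v _; rewrite exp1rz mulr1.
have -> : \sum_(v < n) 1 ^ v%:Z = n%:Z%:~R :> algC.
  by under eq_bigr => v _ do rewrite exp1rz; rewrite sumr_const card_ord.
by rewrite -rmorphB -!rmorphM /= => /eqP; rewrite eqr_int => /eqP.
Qed.

(** * Descent along the powers of [q] *)

Definition dvd_nbrs (l : seq nat) (n : nat) : nat := 2 * count (dvdn n) l.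

Definition residue_sum (n : nat) (f : int -> int) (m : nat) (a : int) : int :=
  \sum_(v < n | (m %| (v%:Z - a)%R)%Z) f v%:Z.

Lemma residue_sum_split (n : nat) (f : int -> int) (q m : nat) (a : int) :
  (0 < q)%N -> (0 < m)%N ->
  residue_sum n f m a =
  \sum_(i < q) residue_sum n f (q * m) (a + (i * m)%N%:Z).
Proof.
move=> q_gt0 m_gt0; rewrite /residue_sum.
under [RHS]eq_bigr do rewrite big_mkcond.
rewrite exchange_big big_mkcond; apply: eq_bigr => v _ /=.
rewrite -[LHS]mulrb -(sum_residue_split _ q_gt0 m_gt0) -sumrMnr.
by apply: eq_bigr => i _; rewrite mulrb opprD addrA.
Qed.

(** At a primitive root of order [q ^ j.+1 > 1] the constant [c] contributes nothing, so one of two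
    factors vanishes; the Ramanujan sums of that factor give the corresponding alternative. *)
Lemma nbr_sum_prim_root (l : seq nat) (f : int -> int) (la c : int) (n q j : nat) :
  prime q -> (0 < n)%N -> (q ^ j.+1 %| n)%N -> (forall v : int, f (v + n%:Z) = f v) ->
  (forall v, nbr_sum l f v = c + la * f v) ->
  (dvd_nbrs l (q ^ j))%:Z - la = q%:Z * ((dvd_nbrs l (q ^ j.+1))%:Z - la) \/
  forall a, residue_sum n f (q ^ j) a = q%:Z * residue_sum n f (q ^ j.+1) a.
Proof.
move=> q_pr n_gt0 qn fper fE.
have q_gt0 : (0 < q ^ j.+1)%N by rewrite expn_gt0 prime_gt0.
have [z zP] := C_prim_root_exists q_gt0.
have zn1 : z ^+ n = 1 by apply/eqP; rewrite -(prim_order_dvd zP).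
have z_neq0 := prim_root_neq0 zP.
have := nbr_sum_fourier n_gt0 zn1 fper fE.
have -> : \sum_(v < n) z ^ v%:Z = 0.
  have z1 : z - 1 != 0.
    rewrite subr_eq0 -[z]expr1 -(prim_order_dvd zP) dvdn1 expnS muln_eq1.
    by rewrite gtn_eqF ?prime_gt1.
  by apply: (mulfI z1); rewrite -subrX1 zn1 subrr mulr0.
rewrite mulr0 => /eqP; rewrite mulf_eq0 => /orP[/eqP Pz0 | /eqP Fz0].
  (* The term [- la] gets exponent 0, which every modulus divides, so it survives in [rE] for every
     [m]. *)
  left; pose r := (0, - la) :: [seq (d%:Z, 1 : int) | d <- l]
                            ++ [seq (- d%:Z, 1 : int) | d <- l].
  have rE (m : nat) : \sum_(i <- r | (m %| i.1)%Z) i.2 = (dvd_nbrs l m)%:Z - la.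
    rewrite big_cons dvdz0 big_cat !big_map /= [LHS]addrC; congr (_ - _).
    under [X in _ + X]eq_bigl => d do rewrite dvdzE abszN.
    rewrite -mulr2n big_const_seq iter_addr_0 -mulrnA natz mulnC.
    by rewrite /dvd_nbrs; congr (2 * _)%N%:Z; apply: eq_count => d; rewrite dvdzE.
  rewrite -!rE; apply: (sum_dvdz_of_prim_root_eq0 q_pr zP).
  rewrite big_cons big_cat !big_map /= expr0z mulr1 rmorphN /= -[RHS]Pz0 [LHS]addrC.
  congr (_ - _). rewrite -big_split; apply: eq_bigr => d _ /=.
  by rewrite !mul1r.
right=> a; apply: (sum_dvdz_of_prim_root_eq0 q_pr zP).
rewrite -[RHS](mulr0 (z ^ (- a))) -[in RHS]Fz0 mulr_sumr; apply: eq_bigr => v _.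
by rewrite expfzDr // mulrA mulrC.
Qed.

Lemma spectral_bound (l : seq nat) (f : int -> int) (la c : int) (n q : nat) :
  prime q -> (0 < n)%N -> la <= 0 -> (forall v : int, f (v + n%:Z) = f v) ->
  (forall v, nbr_sum l f v = c + la * f v) ->
  exists m p : nat, [/\ (m + p)%N = logn q n,
    ((q ^ m)%N %| \sum_(v < n) f v%:Z)%Z &
    (q ^ p)%N%:Z * - la <= (2 * size l)%N%:Z - la].
Proof.
move=> q_pr n_gt0 la_le0 fper fE; set s := logn q n.
have q_gt0 := prime_gt0 q_pr.
pose D j := (dvd_nbrs l (q ^ j))%:Z - la.
(* Here [i] is the number of levels above [j]. At [j = 0] there is a single residue class, the whole
   period. *)
suff claim i j : (j + i)%N = s -> exists m p : nat, [/\ (m + p)%N = i,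
    forall a, ((q ^ m)%N %| residue_sum n f (q ^ j) a)%Z &
    (q ^ p)%N%:Z * - la <= D j].
  have [m [p [mp fdvd Dle]]] := claim s 0%N (add0n s).
  exists m, p; split=> //.
    have := fdvd 0; rewrite /residue_sum.
    by under eq_bigl => v do rewrite expn0 dvd1z.
  move: Dle; rewrite /D /dvd_nbrs expn0.
  by rewrite (eq_count (a2 := predT)) ?count_predT // => d; apply: dvd1n.
elim: i j => [|i IH] j ji.
  exists 0%N, 0%N; split=> [//|a|]; first by rewrite expn0 dvd1z.
  by rewrite expn0 mul1r /D; lia.
have qjn : (q ^ j.+1 %| n)%N by rewrite pfactor_dvdn // -/s; lia.
have [|m [p [mp fdvd Dle]]] := IH j.+1; first by lia.
have [DE | fEq] := nbr_sum_prim_root q_pr n_gt0 qjn fper fE.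
  exists m, p.+1; split=> [|a|]; first by lia.
    (* A class modulo [q ^ j] is a union of classes modulo [q ^ j.+1], so divisibility by [q ^ m] is
       inherited. *)
    rewrite (residue_sum_split _ _ _ q_gt0) ?expn_gt0 ?q_gt0 //.
    by apply: rpred_sum => b _; rewrite -expnS; apply: fdvd.
  by rewrite /D DE expnS PoszM -mulrA ler_pM2l.
exists m.+1, p; split=> [|a|]; first by lia.
  by rewrite fEq (expnS q m) PoszM dvdz_mul.
apply: le_trans Dle _; rewrite /D lerD2r lez_nat /dvd_nbrs leq_mul2l /=.
by apply: sub_count => d; apply: dvdn_trans; rewrite expnS dvdn_mull.
Qed.

(** * Nonzero distances, density and the final bound *)

(** If all distances were 0, the equation at 0 would read [(2 * size l - la) * f 0 = c]. For a
    colouring the left side is 0 or [b + c], neither of which is [c]. *)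
Lemma max_distance_gt0 (l : seq nat) (la c : int) (f : int -> int) :
  (forall v, nbr_sum l f v = c + la * f v) ->
  ((2 * size l)%N%:Z - la) * f 0 != c ->
  exists m : nat, [/\ m \in l, (0 < m)%N & forall d, d \in l -> (d <= m)%N].
Proof.
move=> fE f0c; pose m := (\max_(d <- l) d)%N.
have le_m d : d \in l -> (d <= m)%N by move=> dl; apply: leq_bigmax_seq.
have m_gt0 : (0 < m)%N.
  rewrite lt0n; apply: contra f0c => /eqP m0; rewrite mulrBl subr_eq -fE.
  rewrite /nbr_sum big_seq (eq_bigr (fun=> f 0 + f 0)) => [|d /le_m]; last first.
    by rewrite m0 leqn0 => /eqP ->.
  rewrite -big_seq big_const_seq iter_addr_0 count_predT -mulr2n -mulrnA.
  by rewrite -mulr_natl natz.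
exists m; split=> //; rewrite /m in m_gt0 *.
elim: l {fE f0c m le_m} m_gt0 => [|d l IH]; first by rewrite big_nil.
rewrite big_cons inE; case: (leqP d (\max_(i <- l) i)) => [_ /IH -> | *].
  by rewrite orbT.
by rewrite eqxx.
Qed.

(** After division by the gcd, [q ^ t * q ^ m] divides [(b' + c') * N = c' * n] and is prime to
    [c'], so it divides [n]. *)
Lemma pfactor_density (b c N n q t m : nat) : prime q ->
  (0 < b)%N -> (0 < t)%N -> (0 < n)%N -> (q ^ t %| (b + c) %/ gcdn b c)%N ->
  ((b + c) * N = c * n)%N -> (q ^ m %| N)%N -> (t + m <= logn q n)%N.
Proof.
move=> q_pr b_gt0 t_gt0 n_gt0 t_dvd NE mN; rewrite -pfactor_dvdn // expnD.
have g_gt0 : (0 < gcdn b c)%N by rewrite gcdn_gt0 b_gt0.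
pose b' := (b %/ gcdn b c)%N; pose c' := (c %/ gcdn b c)%N.
have co : coprime (b' + c') c'.
  rewrite /coprime gcdnC gcdnDr gcdnC -(eqn_pmul2r g_gt0) mul1n.
  by rewrite muln_gcdl !divnK ?dvdn_gcdl ?dvdn_gcdr.
have sumE : ((b + c) %/ gcdn b c = b' + c')%N by rewrite divnDl ?dvdn_gcdl.
have NE' : ((b' + c') * N = c' * n)%N.
  apply/eqP; rewrite -(eqn_pmul2r g_gt0) -sumE mulnAC divnK; last first.
    by rewrite dvdn_add ?dvdn_gcdl ?dvdn_gcdr.
  by rewrite NE mulnAC divnK ?dvdn_gcdr.
rewrite sumE in t_dvd.
have /Gauss_dvdr <- : coprime (q ^ t * q ^ m) c'.
  by rewrite -expnD coprimeXl // -(coprime_pexpl _ _ t_gt0) (coprime_dvdl t_dvd).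
by rewrite -NE' dvdn_mul.
Qed.

Local Close Scope ring_scope.

Theorem theorem2 (k b c : nat) (hk : 1 <= k) (hb : 0 < b) (hc : 0 < c)
    (hcol : exists (l : k.-tuple nat) (black : pred int),
        perfect_2colouring (circulant_nbrs l) b c black) :
  forall q t : nat, prime q -> 0 < t -> q ^ t %| (b + c) %/ gcdn b c ->
    b + c <= 2 * k + (b + c) %/ q ^ t.
Proof.
move=> q t q_pr t_gt0 t_dvd; have [l [black colP]] := hcol.
have [small | large] := leqP (b + c) (2 * k); first exact: leq_trans (leq_addr _ _).
pose f x : int := (black x)%:R%R.
have fE v := nbr_sum_perfect v colP; rewrite -/f in fE.
set la := (_ - _)%R in fE.
have [|m [ml m_gt0 le_m]] := max_distance_gt0 fE.
  by rewrite size_tuple /f /la; case: (black _) => /=; lia.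
have [n n_gt0 blackper] := colouring_periodic ml m_gt0 le_m fE.
have fper v : f (v + n%:Z)%R = f v by rewrite /f blackper.
have la_le0 : (la <= 0)%R by rewrite /la; lia.
have [m' [p [mpE mdvd ple]]] := spectral_bound q_pr n_gt0 la_le0 fper fE.
have := sum_nbr_sum n_gt0 fper fE; move: mdvd ple.
have -> : (\sum_(v < n) f v%:Z = (\sum_(v < n) black (Posz v))%N%:Z)%R.
  by rewrite -natz natr_sum.
rewrite size_tuple dvdzE /= => mdvd ple NE.
(* From [pfactor_density], [t + m' <= logn q n = m' + p]. *)
have le_tp : t <= p.
  have : ((b + c) * (\sum_(v < n) black (Posz v)) = c * n)%N.
    by move: NE; rewrite /la subKr -!PoszM => -[].
  by move/(pfactor_density q_pr hb t_gt0 n_gt0 t_dvd)/(_ mdvd); lia.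
rewrite -leq_subLR leq_divRL ?expn_gt0 ?prime_gt0 //.
(* The goal is [(b + c - 2 * k) * q ^ t <= b + c]. With [p >= t] in place of [t] it is [ple], as
   [2 * k - la = b + c]. *)
apply: leq_trans (_ : (b + c - 2 * k) * q ^ p <= b + c).
  by rewrite leq_mul2l leq_pexp2l ?prime_gt0 ?orbT.
rewrite /la in ple; nia.
Qed.
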